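(* Let $\mathcal{Z}$ be a measurable data space, $m\geq 1$ an integer, $\mathcal{H}$ a measurable predictor space, and $\ell:\mathcal{H}\times\mathcal{Z}\to[0,K]$ a measurable loss function bounded by a constant $K>0$. Let $\mu$ be any probability distribution on $\mathcal{Z}^m$ and let $S=(z_1,\dots,z_m)\sim\mu$. Let $(\mathcal{F}_i)_{i\geq 0}$ be a filtration adapted to $S$. Let $\lambda>0$ and $\delta\in(0,1)$. Let $(P_i)_{i=1}^m$ be any online predictive sequence of stochastic kernels, and let $(Q_i)_{i=1}^m$ be any sequence of stochastic kernels from $\mathcal{Z}^m$ to $\mathcal{H}$. Writing $Q_{i,S}:=Q_i(S,\cdot)$ and $P_{i,S}:=P_i(S,\cdot)$, with probability at least $1-\delta$ over $S\sim\mu$, \[ \sum_{i=1}^m \mathbb{E}_{h_i\sim Q_{i,S}}\Big[\mathbb{E}[\ell(h_i,z_i)\mid\mathcal{F}_{i-1}]\Big]\leq \sum_{i=1}^m\Big(\mathbb{E}_{h_i\sim Q_{i,S}}[\ell(h_i,z_i)]+\frac{\operatorname{KL}(Q_{i,S}\|P_{i,S})}{\lambda}\Big)+\frac{\lambda m K^2}{2}+\frac{\log(1/\delta)}{\lambda}. \] Here $\mathbb{E}[\ell(h,z_i)\mid\mathcal{F}_{i-1}]$ denotes the conditional expectation for a fixed $h$, then evaluated at $h=h_i$.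
   Context: A stochastic kernel from $\mathcal{Z}^m$ to $\mathcal{H}$ (with $\sigma$-algebra $\Sigma_{\mathcal{H}}$) is a map $Q:\mathcal{Z}^m\times\Sigma_{\mathcal{H}}\to[0,1]$ such that for every $B\in\Sigma_{\mathcal{H}}$, $S\mapsto Q(S,B)$ is measurable, and for every $S$, $B\mapsto Q(S,B)$ is a probability measure on $\mathcal{H}$. A sequence of stochastic kernels $(P_i)_{i=1}^m$ is an online predictive sequence if (i) for all $i\geq1$ and all $S$, $P_i(S,\cdot)$ is $\mathcal{F}_{i-1}$-measurable (it depends on the data only through $\mathcal{F}_{i-1}$; in particular $P_1(S,\cdot)$ is a data-free probability measure), and (ii) for all $i\geq 2$, $P_i(S,\cdot)$ is absolutely continuous with respect to $P_{i-1}(S,\cdot)$. $\operatorname{KL}$ denotes the Kullback–Leibler divergence (equal to $+\infty$ when the first measure is not absolutely continuous w.r.t. the second). No assumption (such as independence) is made on $\mu$. *)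

(* Defs.v *)
From HB Require Import structures.
From mathcomp Require Import all_boot all_order all_algebra.
From mathcomp Require Import all_classical all_reals all_analysis measurable_realfun.
Set Implicit Arguments. Unset Strict Implicit. Unset Printing Implicit Defensive.
Import Order.TTheory GRing.Theory Num.Theory.
Local Open Scope classical_set_scope.
Local Open Scope ring_scope.

Definition measurable_wrt d' (T : Type) (Y : measurableType d')
    (G : set (set T)) (f : T -> Y) : Prop :=
  forall B : set Y, measurable B -> G (f @^-1` B).

Definition filtration d (Z : measurableType d) (m : nat)
    (F : nat -> set (set (m.-tuple Z))) : Prop :=
  (forall i, sigma_algebra [set: m.-tuple Z] (F i)) /\
  (forall i, F i `<=` measurable) /\
  (forall i, F i `<=` F i.+1).

(** [F] is adapted to S = (z_1,...,z_m): z_{i+1} (coordinate [i], 0-based)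
    is F_{i+1}-measurable. *)
Definition adapted d (Z : measurableType d) (m : nat)
    (F : nat -> set (set (m.-tuple Z))) : Prop :=
  forall i : 'I_m, measurable_wrt (F i.+1) (fun S : m.-tuple Z => tnth S i).

Definition is_cond_exp d (T : measurableType d) (R : realType)
    (mu : {measure set T -> \bar R}) (G : set (set T)) (f g : T -> R) : Prop :=
  [/\ measurable_wrt G g,
      mu.-integrable [set: T] (EFin \o g) &
      forall A, G A -> (\int[mu]_(x in A) (g x)%:E = \int[mu]_(x in A) (f x)%:E)%E].

Definition stoch_kernel d d' (X : measurableType d) (H : measurableType d')
    (R : realType) (K : X -> probability H R) : Prop :=
  forall B : set H, measurable B -> measurable_fun [set: X] ((fun S => K S B) : X -> \bar R).

(** Online predictive sequence (P_1, ..., P_m) (0-based: P i = P_{i+1}). *)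
Definition online_predictive d d' (Z : measurableType d) (H : measurableType d')
    (R : realType) (m : nat) (F : nat -> set (set (m.-tuple Z)))
    (P : 'I_m -> m.-tuple Z -> probability H R) : Prop :=
  [/\ forall i, stoch_kernel (P i),
      forall (i : 'I_m) (B : set H), measurable B ->
        measurable_wrt (F i) ((fun S => P i S B) : m.-tuple Z -> \bar R),
      forall i : 'I_m, (i : nat) = 0%N -> forall S S', P i S = P i S' &
      forall (i j : 'I_m), (j : nat) = i.+1 -> forall S,
        (P j S : set H -> \bar R) `<< (P i S : set H -> \bar R)].

Definition KL d (H : measurableType d) (R : realType) (Q P : probability H R)
  : \bar R :=
  match pselect ((Q : set H -> \bar R) `<< (P : set H -> \bar R)) with
  | left _ => (\int[Q]_h
       (ln (fine (Radon_Nikodym (charge_of_finite_measure Q) P h)))%:E)%E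
  | right _ => +oo%E
  end.

(* Main.v *)
(** By Donsker-Varadhan, [lambda * Q_i (E[l | F_(i-1)] - l) - a] is at most
    [KL(Q_i || P_i) + ln xi_i], where [a = lambda^2 K^2 / 2] and [xi_i] is the
    [P_i]-average of [exp (lambda * (E[l | F_(i-1)] - l) - a)].  Summing over
    [i], it suffices that [E (xi_1 ... xi_m) <= 1] and to apply Markov's
    inequality.  For a fixed [h], each exponential has conditional expectation
    at most 1, by [exp (-y) <= 1 - y + y^2/2] for [y >= 0].

    The conditional expectations are only given for each fixed [h], so that
    [xi_i] need not be measurable with respect to the filtration.  Instead,
    [P_i] is dominated by the data-free [P_1], hence has a density with respect
    to [P_1] that is jointly measurable for [F_(i-1)] (Radon-Nikodym on the
    product with the sub-sigma-algebra).  By Tonelli the averages over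
    [h_1, ..., h_m] can be moved outside the expectation over the data, where
    the bounds for fixed [h_i] apply successively, from [i = m] down to [1]. *)

Require Import Defs.
From HB Require Import structures.
From mathcomp Require Import all_boot all_order all_algebra.
From mathcomp Require Import all_classical all_reals all_analysis measurable_realfun.
From mathcomp Require Import ring lra.
Import Order.TTheory GRing.Theory Num.Theory.
Local Open Scope classical_set_scope.
Local Open Scope ring_scope.
Set Implicit Arguments.
Unset Strict Implicit.
Unset Printing Implicit Defensive.

(** * Measures with a density *)

Section density_measure.
Context d (T : measurableType d) (R : realType).
Variables (mu : {measure set T -> \bar R}) (p : T -> R).
Hypotheses (p0 : forall x, 0 <= p x) (mp : measurable_fun [set: T] p).
Local Open Scope ereal_scope.

(** The proofs about [p] are arguments so that the measure structure can be attached to the term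
    [density p0 mp]. *)
Definition density & (forall x, (0 <= p x)%R) & measurable_fun [set: T] p :=
  fun A : set T => \int[mu]_(x in A) (p x)%:E.

Let mpE : measurable_fun [set: T] (EFin \o p).
Proof. exact/measurable_EFinP. Qed.

Let density0 : density p0 mp set0 = 0.
Proof. exact: integral_set0. Qed.

Let density_ge0 A : 0 <= density p0 mp A.
Proof. by apply: integral_ge0 => x _; rewrite lee_fin. Qed.

Let density_sigma_additive : semi_sigma_additive (density p0 mp).
Proof.
move=> F mF tF mUF; rewrite /density ge0_integral_bigcup//; last 2 first.
- exact: measurable_funTS.
- by move=> x _; rewrite lee_fin.
by apply: is_cvg_nneseries => n _ _; exact: density_ge0.
Qed.

HB.instance Definition _ := isMeasure.Build _ _ _ (density p0 mp)
  density0 density_ge0 density_sigma_additive.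

Import HBNNSimple.

(** Monotone convergence along simple functions reduces both sides to level sets, where the identity
    is the definition of [density]. *)
Lemma ge0_integral_density (f : T -> \bar R) : (forall x, 0 <= f x) ->
    measurable_fun [set: T] f ->
  \int[density p0 mp]_x f x = \int[mu]_x (f x * (p x)%:E).
Proof.
move=> f0 mf; pose h := nnsfun_approx measurableT mf.
have cvgh x : (h n x)%:E @[n --> \oo] --> f x.
  exact: (cvg_nnsfun_approx measurableT mf (fun x _ => f0 x)).
have mh n : measurable_fun [set: T] (EFin \o h n) by exact/measurable_EFinP.
have ndh x : {homo (fun n => (h n x)%:E) : m n / (m <= n)%N >-> m <= n}.
  by move=> a b ab; rewrite lee_fin; exact/lefP/nd_nnsfun_approx.
transitivity (lim (\int[density p0 mp]_x (h n x)%:E @[n --> \oo])).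
  rewrite -monotone_convergence//; last by move=> n x _; rewrite lee_fin.
  by apply: eq_integral => x _; exact/esym/cvg_lim.
transitivity (lim (\int[mu]_x ((h n x)%:E * (p x)%:E) @[n --> \oo])); last first.
  rewrite -monotone_convergence//; last 3 first.
  - by move=> n; exact: emeasurable_funM (mh n) mpE.
  - by move=> n x _; rewrite mule_ge0 ?lee_fin.
  - by move=> x _ a b ab; rewrite lee_wpmul2r ?lee_fin ?p0// -lee_fin ndh.
  by apply: eq_integral => x _; apply/cvg_lim => //; exact: cvgeZr.
suff E n : \int[density p0 mp]_x (h n x)%:E = \int[mu]_x ((h n x)%:E * (p x)%:E).
  by under eq_fun do rewrite E.
have mi r : measurable_fun [set: T] (fun x => (r * \1_(h n @^-1` [set r]) x)%:E).
  by apply/measurable_EFinP; exact: measurable_funM.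
under [LHS]eq_integral do rewrite fimfunE -fsumEFin//.
rewrite ge0_integral_fsum//; last by move=> r x _; exact: nnfun_muleindic_ge0.
under [RHS]eq_integral => x _.
  rewrite fimfunE -fsumEFin// ge0_mule_fsuml//; last first.
    by move=> r; exact: nnfun_muleindic_ge0.
  over.
rewrite ge0_integral_fsum//; last 2 first.
- by move=> r; exact: emeasurable_funM.
- by move=> r x _; rewrite mule_ge0 ?lee_fin// -lee_fin nnfun_muleindic_ge0.
apply: eq_fsbigr => r /[!inE] -[x _ rE].
rewrite integralZl_indic_nnsfun// integral_indic// setIT.
under eq_integral do rewrite EFinM -muleA.
rewrite ge0_integralZl//; last 3 first.
- by apply: emeasurable_funM => //; exact/measurable_EFinP.
- by move=> y _; rewrite mule_ge0 ?lee_fin.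
- by rewrite lee_fin -rE.
congr (_ * _); rewrite /density [LHS]integral_mkcond epatch_indic.
by apply: eq_integral => y _; rewrite muleC.
Qed.

End density_measure.

(** * Monotonicity of integrals in the measure and in the integrand *)

Section integral_monotonicity.
Context d (T : measurableType d) (R : realType).
Implicit Types (m : {measure set T -> \bar R}) (f g : T -> \bar R).
Local Open Scope ereal_scope.

Import HBNNSimple.

(** The integral of a nonnegative function is a supremum over simple functions below it, so it
    suffices to compare the measures on level sets. *)
Lemma ge0_integral_le_measure m1 m2 f :
    (forall A, measurable A -> m1 A <= m2 A) -> (forall x, 0 <= f x) ->
  \int[m1]_x f x <= \int[m2]_x f x.
Proof.
move=> m12 f0; rewrite !ge0_integralTE//.
apply: ge_ereal_sup => _ [h hf <-].
apply: (@le_trans _ _ (sintegral m2 h)); last first.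
  by apply: ereal_sup_ubound; exists h; [exact: hf|].
rewrite !sintegralE; apply: lee_fsum => [//|r _].
have [r0|r0] := leP 0%R r; first by rewrite lee_wpmul2l ?lee_fin// m12.
by rewrite preimage_nnfun0// !measure0.
Qed.

(* Sound also for non-integrable functions: [oo - oo = -oo] makes subtraction monotone. *)
Lemma le_integral_measurable m D f g : measurable D ->
    measurable_fun D f -> measurable_fun D g ->
    (forall x, D x -> f x <= g x) -> \int[m]_(x in D) f x <= \int[m]_(x in D) g x.
Proof.
move=> mD mf mg fg; rewrite [leLHS]integralE [leRHS]integralE; apply: leeB.
- apply: ge0_le_integral => //; [exact: measurable_funepos..|].
  by move=> x Dx; rewrite !funeposE le_max2 ?fg.
- apply: ge0_le_integral => //; [exact: measurable_funeneg..|].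
  by move=> x Dx; rewrite !funenegE le_max2 ?leeN2 ?fg.
Qed.

End integral_monotonicity.

(** * Probability-valued maps as kernels *)

Section kernel_of_probabilities.
Context d d' (T : measurableType d) (H : measurableType d') (R : realType).
Local Open Scope ereal_scope.

Definition kernel_of (P : T -> probability H R) & stoch_kernel P :
  T -> {measure set H -> \bar R} := P.

Section instances.
Variables (P : T -> probability H R) (mP : stoch_kernel P).

HB.instance Definition _ := isKernel.Build _ _ _ _ _ (kernel_of mP) mP.

Let kernel_ofT x : kernel_of mP x [set: H] = 1.
Proof. exact: probability_setT. Qed.

HB.instance Definition _ := Kernel_isProbability.Build _ _ _ _ _
  (kernel_of mP) kernel_ofT.

End instances.

Lemma measurable_integral_kernel (P : T -> probability H R) (f : T * H -> \bar R) :
    stoch_kernel P -> (forall z, 0 <= f z) -> measurable_fun [set: T * H] f ->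
  measurable_fun [set: T] (fun x => \int[P x]_h f (x, h)).
Proof.
move=> mP f0 mf.
exact: (measurable_fun_integral_finite_kernel f (kernel_of mP) f0 mf).
Qed.

End kernel_of_probabilities.

(** * Joint law of a point and a draw from its kernel *)

Section joint_law.
Context d d' (T : measurableType d) (H : measurableType d') (R : realType).
Variables (mu : probability T R) (P : T -> probability H R).
Hypothesis mP : stoch_kernel P.
Local Open Scope ereal_scope.

(** The source is a pair because kernel composition feeds its second kernel the starting point
    together with the intermediate point [x.2]. *)
Definition slice (_ : stoch_kernel P) (x : T * T) :
  {measure set (T * H) -> \bar R} := \d_(x.2) \x P x.2.

Lemma slice_xsection x (C : set (T * H)) : measurable C ->
  slice mP x C = P x.2 (xsection C x.2).
Proof.
move=> mC; rewrite /slice /= /product_measure1 integral_dirac//.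
  by rewrite diracT mul1e.
exact: measurable_fun_xsection.
Qed.

Let measurable_slice (C : set (T * H)) : measurable C ->
  measurable_fun [set: T * T] (slice mP ^~ C).
Proof.
move=> mC; rewrite [X in measurable_fun _ X](_ : _ =
    (fun x => P x (xsection C x)) \o snd); last first.
  by apply/funext => x; rewrite slice_xsection.
apply: measurableT_comp => //.
by apply: (measurable_fun_xsection_finite_kernel (kernel_of mP)); rewrite inE.
Qed.

HB.instance Definition _ := isKernel.Build _ _ _ _ _ (slice mP) measurable_slice.

Let sliceT x : slice mP x [set: T * H] = 1.
Proof. by rewrite slice_xsection// -setXTT in_xsectionX ?inE// probability_setT. Qed.

HB.instance Definition _ := Kernel_isProbability.Build _ _ _ _ _ (slice mP) sliceT.

Let mmu : stoch_kernel (fun _ : T => mu).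
Proof. by move=> B mB; exact: measurable_cst. Qed.

(** The law of [(x, h)] with [x] drawn from [mu], then [h] from [P x]. The first kernel is constant,
    so the starting [point] is arbitrary. *)
Definition joint : set (T * H) -> \bar R := mkcomp (kernel_of mmu) (slice mP) point.

HB.instance Definition _ := Measure.on joint.

Lemma jointE (C : set (T * H)) : measurable C ->
  joint C = \int[mu]_x P x (xsection C x).
Proof. by move=> mC; apply: eq_integral => x _; exact: slice_xsection. Qed.

Let jointT : joint [set: T * H] = 1.
Proof.
rewrite jointE//; under eq_integral do rewrite -setXTT in_xsectionX ?inE// probability_setT.
by rewrite integral_cst// mul1e; exact: probability_setT.
Qed.

HB.instance Definition _ := Measure_isProbability.Build _ _ _ joint jointT.

Lemma ge0_integral_joint (f : T * H -> \bar R) : (forall z, 0 <= f z) ->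
    measurable_fun [set: T * H] f ->
  \int[joint]_z f z = \int[mu]_x \int[P x]_h f (x, h).
Proof.
move=> f0 mf; rewrite [LHS](integral_kcomp (kernel_of mmu) (slice mP))//.
apply: eq_integral => x _; rewrite [LHS]fubini_tonelli1//.
rewrite integral_dirac ?diracT ?mul1e//.
exact: measurable_fun_fubini_tonelli_F.
Qed.

End joint_law.

(** * Restriction to a sub-sigma-algebra *)

Section sub_sigma_algebra.
Context d (T : measurableType d) (R : realType).
Variable G : set (set T).
Hypotheses (sG : sigma_algebra [set: T] G) (Gm : G `<=` measurable).
Local Open Scope ereal_scope.
Local Notation TG := (g_sigma_algebraType G).

(** [TG] is [T] with the sigma-algebra generated by [G], which is [G] itself; measurability for [G]
    thus becomes ordinary measurability on another space. *)
Lemma measurable_wrtP d' (Y : measurableType d') (f : T -> Y) :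
  measurable_wrt G f <-> measurable_fun [set: TG] (f : TG -> Y).
Proof.
split=> [Gf _ B mB|mf B mB].
  by rewrite setTI measurable_g_measurableTypeE//; exact: Gf.
by have := mf measurableT B mB; rewrite setTI measurable_g_measurableTypeE.
Qed.

Lemma measurable_fun_to_sub : measurable_fun [set: T] (idfun : T -> TG).
Proof.
by move=> _ A; rewrite measurable_g_measurableTypeE// setTI => /Gm.
Qed.

Lemma measurable_fun_of_sub d' (Y : measurableType d') (f : T -> Y) :
  measurable_fun [set: TG] (f : TG -> Y) -> measurable_fun [set: T] f.
Proof. by move=> mf; exact: (measurableT_comp mf measurable_fun_to_sub). Qed.

Lemma measurable_fun_of_subX d' d'' (H : measurableType d')
    (Y : measurableType d'') (f : T * H -> Y) :
  measurable_fun [set: TG * H] (f : TG * H -> Y) -> measurable_fun [set: T * H] f.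
Proof.
move=> mf.
have mg : measurable_fun [set: T * H] (fun z : T * H => (z.1 : TG, z.2)).
  apply: measurable_fun_pair => //.
  exact: (measurableT_comp measurable_fun_to_sub (@measurable_fst _ _ T H)).
rewrite (_ : f = (f : TG * H -> Y) \o (fun z : T * H => (z.1 : TG, z.2))).
  exact: measurableT_comp mf mg.
by apply/funext => -[].
Qed.

Section sub_measure.
Variable mu : {measure set T -> \bar R}.

Definition sub_measure (_ : sigma_algebra [set: T] G) (_ : G `<=` measurable) :
  set TG -> \bar R := mu.

Local Notation muG := (sub_measure sG Gm).

Let sub_measure0 : muG set0 = 0. Proof. exact: measure0. Qed.

Let sub_measure_ge0 A : 0 <= muG A. Proof. exact: measure_ge0. Qed.

Let sub_sigma_additive : semi_sigma_additive muG.
Proof.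
have mT (A : set TG) : measurable A -> measurable (A : set T).
  by rewrite measurable_g_measurableTypeE// => /Gm.
move=> F mF tF mUF; apply: (measure_semi_sigma_additive (s := mu)) => //.
- by move=> n; exact: mT (mF n).
- exact: mT.
Qed.

HB.instance Definition _ := isMeasure.Build _ _ _ muG
  sub_measure0 sub_measure_ge0 sub_sigma_additive.

(** [sub_measure] is the pushforward of [mu] under the identity from [T] to [TG]. *)
Lemma ge0_integral_sub_measure (f : T -> \bar R) :
    measurable_fun [set: TG] (f : TG -> \bar R) -> (forall x, 0 <= f x) ->
  \int[muG]_x f x = \int[mu]_x f x.
Proof.
move=> mf f0.
by rewrite -[RHS](ge0_integral_pushforward measurable_fun_to_sub mu measurableT).
Qed.

End sub_measure.

Section sub_prob.
Variable mu : probability T R.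

Let sub_probT : sub_measure mu sG Gm setT = 1. Proof. exact: probability_setT. Qed.

HB.instance Definition _ := Measure_isProbability.Build _ _ _
  (sub_measure mu sG Gm) sub_probT.

Definition sub_prob : probability TG R := sub_measure mu sG Gm.

End sub_prob.

End sub_sigma_algebra.

(** * Rectangles and uniqueness of measures on a product *)

Section rectangles.
Context d d' (T : measurableType d) (H : measurableType d') (R : realType).
Local Open Scope ereal_scope.

Lemma ge0_integral_rectangle (m1 : {sigma_finite_measure set T -> \bar R})
    (m2 : {sigma_finite_measure set H -> \bar R}) (f : T * H -> \bar R) A B :
    measurable A -> measurable B ->
    measurable_fun [set: T * H] f -> (forall z, 0 <= f z) ->
  \int[m1 \x m2]_(z in A `*` B) f z = \int[m1]_(x in A) \int[m2]_(y in B) f (x, y).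
Proof.
move=> mA mB mf f0; have mAB : measurable (A `*` B) by exact: measurableX.
rewrite integral_mkcond fubini_tonelli1//; last 2 first.
- by apply/(measurable_restrictT _ mAB); exact: measurable_funTS.
- by move=> z; rewrite patchE; case: ifP.
rewrite [RHS]integral_mkcond; apply: eq_integral => x _.
rewrite patchE /fubini_F; have [xA|xA] := boolP (x \in A).
  rewrite [RHS]integral_mkcond; apply: eq_integral => y _.
  by rewrite !patchE in_setX xA.
by apply: integral0_eq => y _; rewrite patchE in_setX (negbTE xA).
Qed.

Lemma measurable_fun_integral_section (m2 : {sigma_finite_measure set H -> \bar R})
    (f : T * H -> \bar R) B : measurable B ->
    measurable_fun [set: T * H] f -> (forall z, 0 <= f z) ->
  measurable_fun [set: T] (fun x => \int[m2]_(y in B) f (x, y)).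
Proof.
move=> mB mf f0.
have mTB : measurable ([set: T] `*` B) by exact: measurableX.
rewrite (_ : (fun x => _) = fubini_F m2 (f \_ ([set: T] `*` B))).
  apply: measurable_fun_fubini_tonelli_F => [|z].
    by apply/(measurable_restrictT _ mTB); exact: measurable_funTS.
  by rewrite patchE; case: ifP.
apply/funext => x; rewrite integral_mkcond; apply: eq_integral => y _.
by rewrite !patchE in_setX in_setT.
Qed.

Lemma joint_rectangle (mu : probability T R) (P : T -> probability H R)
    (mP : stoch_kernel P) A B : measurable A -> measurable B ->
  joint mu mP (A `*` B) = \int[mu]_(x in A) P x B.
Proof.
move=> mA mB; rewrite jointE; last exact: measurableX.
rewrite [RHS]integral_mkcond; apply: eq_integral => x _.
rewrite patchE; case: ifPn => xA; first by rewrite in_xsectionX.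
by rewrite notin_xsectionX// measure0.
Qed.

(** Rectangles are stable under intersection, generate the product sigma-algebra and include the
    whole space, which has finite mass. *)
Lemma rectangle_measure_eq (m1 m2 : {measure set (T * H) -> \bar R}) :
    m1 [set: T * H] < +oo ->
    (forall A B, measurable A -> measurable B -> m1 (A `*` B) = m2 (A `*` B)) ->
  forall C, measurable C -> m1 C = m2 C.
Proof.
move=> m1T m12 C mC.
pose rect := [set A `*` B | A in @measurable _ T & B in @measurable _ H].
apply: (@measure_unique _ _ _ rect (fun=> setT)) => //.
- by rewrite measurable_prod_measurableType.
- move=> _ _ [A1 mA1 [B1 mB1 <-]] [A2 mA2 [B2 mB2 <-]].
  by exists (A1 `&` A2); [exact: measurableI|]; exists (B1 `&` B2);
    [exact: measurableI|rewrite setXI].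
- by move=> _; exists setT => //; exists setT => //; rewrite setXTT.
- by rewrite bigcup_const.
- by move=> _ [A mA [B mB <-]]; exact: m12.
Qed.

End rectangles.

(** * Jointly measurable density of a kernel over a sub-sigma-algebra *)

Section kernel_density.
Context d d' (T : measurableType d) (H : measurableType d') (R : realType).
Variables (mu : probability T R) (G : set (set T)).
Hypotheses (sG : sigma_algebra [set: T] G) (Gm : G `<=` measurable).
Variables (P : T -> probability H R) (pi : probability H R).
Hypothesis GP : forall B, measurable B ->
  measurable_wrt G ((fun x => P x B) : T -> \bar R).
Hypothesis Ppi : forall x, (P x : set H -> \bar R) `<< (pi : set H -> \bar R).
Local Open Scope ereal_scope.
Local Notation TG := (g_sigma_algebraType G).
Local Notation muG := (sub_prob sG Gm mu).

Let mPG : stoch_kernel (P : TG -> probability H R).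
Proof. by move=> B mB; apply/(measurable_wrtP sG); exact: GP. Qed.

Let mP : stoch_kernel P.
Proof. by move=> B mB; apply: (measurable_fun_of_sub sG Gm); exact: mPG. Qed.

Let prodG : probability (TG * H)%type R := muG \x pi.

(** A [prodG]-null set has [pi]-null sections at almost every [x], and these are [P x]-null. *)
Let joint_dominated : (joint muG mPG : set (TG * H) -> \bar R) `<<
  (prodG : set (TG * H) -> \bar R).
Proof.
apply/null_content_dominatesP => C mC C0; rewrite jointE//.
have : ae_eq muG [set: TG] (fun x => pi (xsection C x)) (cst 0).
  apply/ae_eq_integral_abs => //; first exact: measurable_fun_xsection.
  by rewrite -[RHS]C0; apply: eq_integral => x _; rewrite gee0_abs.
move=> pi0; transitivity (\int[muG]_x (cst 0 x)); last by rewrite integral0.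
apply: ae_eq_integral => //.
  by apply: (measurable_fun_xsection_finite_kernel (kernel_of mPG)); rewrite inE.
apply: filterS pi0 => x /(_ I) /= pi0 _.
have /null_content_dominatesP := @Ppi x; apply => //.
exact: measurable_xsection.
Qed.

Local Notation RN := (Radon_Nikodym_SigmaFinite.f (joint muG mPG) prodG).
Let p z := fine (RN z).

Let pE z : (p z)%:E = RN z.
Proof. by rewrite /p fineK//; exact: Radon_Nikodym_SigmaFinite.f_fin_num. Qed.

Let p0 z : (0 <= p z)%R.
Proof. by rewrite -lee_fin pE; exact: Radon_Nikodym_SigmaFinite.f_ge0. Qed.

Let mpG : measurable_fun [set: TG * H] (p : TG * H -> R).
Proof.
apply/measurable_EFinP; apply: (eq_measurable_fun RN) => [z _|].
  by rewrite /= pE.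
by have /integrableP[] := Radon_Nikodym_SigmaFinite.f_integrable joint_dominated.
Qed.

Let mp : measurable_fun [set: T * H] p.
Proof. exact: (measurable_fun_of_subX sG Gm). Qed.

(** Both sides have the same integral over every set of [TG], by the density of the joint law on
    rectangles. The exceptional null set depends on [B]. *)
Let kernel_density_ae B : measurable B ->
  ae_eq muG [set: TG] (fun x => P x B) (fun x => \int[pi]_(h in B) (p (x, h))%:E).
Proof.
move=> mB; apply: integral_ae_eq => //.
- apply: (@le_integrable _ _ _ muG _ measurableT _ (EFin \o cst 1%R)) => [|x _|].
  - exact: mPG.
  - by rewrite gee0_abs//= normr1 probability_le1.
  - exact: finite_measure_integrable_cst.
- apply: (@measurable_fun_integral_section _ _ TG H R pi (EFin \o p)) => //.
  exact/measurable_EFinP.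
- move=> A _ mA.
  rewrite -(joint_rectangle muG mPG)//.
  rewrite (Radon_Nikodym_SigmaFinite.f_integral joint_dominated); last exact: measurableX.
  rewrite -(@ge0_integral_rectangle _ _ TG H R muG pi (EFin \o p))//; last first.
    exact/measurable_EFinP.
  by apply: eq_integral => z _; rewrite /= pE.
Qed.

(** With one null set per [B], the density is only usable after integration over [mu]: two measures
    agree on rectangles, hence everywhere. Here [f] may be measurable for all of [T], while [p] is
    measurable over [TG]; this lets [f] contain factors from the future. *)
Lemma kernel_density : exists p : T * H -> R, [/\ forall z, (0 <= p z)%R,
  measurable_fun [set: TG * H] (p : TG * H -> R) &
  forall f : T * H -> \bar R, (forall z, 0 <= f z) ->
    measurable_fun [set: T * H] f ->
    \int[mu]_x \int[P x]_h f (x, h) =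
    \int[mu]_x \int[pi]_h (f (x, h) * (p (x, h))%:E)].
Proof.
exists p; split => // f f0 mf.
rewrite -(ge0_integral_joint mu mP)//.
transitivity (\int[density (mu \x pi) p0 mp]_z f z); last first.
  rewrite ge0_integral_density// fubini_tonelli1//.
  - by apply: emeasurable_funM => //; exact/measurable_EFinP.
  - by move=> z; rewrite mule_ge0 ?lee_fin.
apply: eq_measure_integral => C mC _.
apply: rectangle_measure_eq => // [|A B mA mB].
  by rewrite [ltLHS](probability_setT (joint mu mP)) ltry.
rewrite [LHS](joint_rectangle mu mP mA mB).
rewrite [RHS](@ge0_integral_rectangle _ _ T H R mu pi (EFin \o p))//; last first.
  exact/measurable_EFinP.
apply: ae_eq_integral => //.
- exact/measurable_funTS/mP.
- apply: measurable_funTS.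
  apply: (@measurable_fun_integral_section _ _ T H R pi (EFin \o p)) => //.
  exact/measurable_EFinP.
have [N [mN N0 sN]] := kernel_density_ae mB.
exists N; split => //.
  by apply: Gm; rewrite -(measurable_g_measurableTypeE sG).
by apply: subset_trans sN; apply: subsetC => x /(_ I) /= + _.
Qed.

End kernel_density.

(** * Quadratic bounds on the exponential *)

Section exponential_bounds.
Context (R : realType).

Lemma expR_ge_quadratic (y : R) : 0 <= y -> 1 + y + y ^+ 2 / 2 <= expR y.
Proof.
move=> y0; rewrite (_ : _ + _ = series (exp_coeff y) 3).
  apply: nondecreasing_cvgn_le; last exact: is_cvg_series_exp_coeff.
  apply/nondecreasing_seqP => n; rewrite /series /= big_nat_recr//= lerDl.
  exact: exp_coeff_ge0.
by rewrite /series /= !big_nat_recr//= big_nil /exp_coeff /= expr0 expr1 add0r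
  fact0 !divr1.
Qed.

(** Invert the previous bound, using [(1 + y + y^2/2) (1 - y + y^2/2) = 1 + y^4/4]. *)
Lemma expRN_le_quadratic (y : R) : 0 <= y -> expR (- y) <= 1 - y + y ^+ 2 / 2.
Proof.
move=> y0; have q0 : 0 < 1 + y + y ^+ 2 / 2 by nra.
rewrite expRN; apply: (@le_trans _ _ (1 + y + y ^+ 2 / 2)^-1).
  by rewrite lef_pV2 ?posrE ?expR_gt0// expR_ge_quadratic.
by rewrite -[leLHS]mul1r ler_pdivrMr//; nra.
Qed.

End exponential_bounds.

(** * Conditional exponential moment for a fixed predictor *)

Section conditional_exponential_moment.
Context d (T : measurableType d) (R : realType).
Variables (mu : probability T R) (G : set (set T)).
Hypotheses (sG : sigma_algebra [set: T] G) (Gm : G `<=` measurable).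
Local Open Scope ereal_scope.
Local Notation TG := (g_sigma_algebraType G).

(** Restricted to [G], the measure with density [p] lies below the one with density [q]; [V] is
    integrated against these restrictions. *)
Lemma le_integral_sub (p q : T -> R) (V : T -> \bar R) :
    (forall x, (0 <= p x)%R) -> (forall x, (0 <= q x)%R) ->
    measurable_fun [set: T] p -> measurable_fun [set: T] q ->
    (forall A, G A -> \int[mu]_(x in A) (p x)%:E <= \int[mu]_(x in A) (q x)%:E) ->
    (forall x, 0 <= V x) -> measurable_wrt G V ->
  \int[mu]_x (V x * (p x)%:E) <= \int[mu]_x (V x * (q x)%:E).
Proof.
move=> p0 q0 mp mq pq V0 mV.
have mVG : measurable_fun [set: TG] (V : TG -> \bar R) by exact/measurable_wrtP.
have mVT : measurable_fun [set: T] V by exact: (measurable_fun_of_sub sG Gm).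
rewrite -(ge0_integral_density mu p0 mp)// -(ge0_integral_density mu q0 mq)//.
rewrite -!(ge0_integral_sub_measure sG Gm)//.
apply: ge0_integral_le_measure => // A.
by rewrite measurable_g_measurableTypeE// => GA; exact: (pq A GA).
Qed.

Variables (X c : T -> R) (K lambda : R).
Hypotheses (mX : measurable_fun [set: T] X) (XK : forall x, (0 <= X x <= K)%R).
Hypotheses (lambda0 : (0 < lambda)%R) (Xc : is_cond_exp mu G X c).
Let a := (lambda ^+ 2 * K ^+ 2 / 2)%R.

Let mc : measurable_fun [set: T] c.
Proof.
by case: Xc => /(measurable_wrtP sG) mc _ _; exact: (measurable_fun_of_sub sG Gm).
Qed.

Let integral_affine (f : T -> R) A : measurable A ->
    mu.-integrable [set: T] (EFin \o f) ->
  \int[mu]_(x in A) (1 + a - lambda * f x)%:E =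
  (1 + a)%:E * mu A - lambda%:E * \int[mu]_(x in A) (f x)%:E.
Proof.
move=> mA intf; have intAf : mu.-integrable A (EFin \o f).
  exact: integrableS intf.
under eq_integral do rewrite EFinB EFinM.
rewrite integralB//; last 2 first.
- exact: finite_measure_integrable_cst.
- exact: integrableZl.
by rewrite integralZl// integral_cst.
Qed.

(** Since [X <= K], [expR (- (lambda * X))] is at most the affine [p]. On sets of [G], [p]
    integrates like [1 + a - lambda * c], which is at most [q = expR (a - lambda * c)]. The
    remaining factor [expR (lambda * c - a)] is measurable for [G] and cancels [q]. *)
Lemma cond_exp_exponential_moment (V : T -> \bar R) :
    (forall x, 0 <= V x) -> measurable_wrt G V ->
  \int[mu]_x (V x * (expR (lambda * (c x - X x) - a))%:E) <= \int[mu]_x V x.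
Proof.
move=> V0 mV; have [mcG intc cE] := Xc.
have intX : mu.-integrable [set: T] (EFin \o X).
  apply: (@le_integrable _ _ _ mu _ measurableT _ (EFin \o cst K)) => [|x _|].
  - exact/measurable_EFinP.
  - have /andP[X0 XleK] := XK x.
    by rewrite /= lee_fin !ger0_norm// (le_trans X0).
  - exact: finite_measure_integrable_cst.
pose p x := (1 + a - lambda * X x)%R.
pose q x := expR (a - lambda * c x).
have pX x : (expR (- (lambda * X x)) <= p x)%R.
  have /andP[X0 XleK] := XK x.
  apply: (le_trans (expRN_le_quadratic _)); first by rewrite mulr_ge0// ltW.
  rewrite /p /a addrAC lerD2r lerD2l ler_pM2r ?invr_gt0//.
  by rewrite exprMn ler_pM2l ?exprn_gt0// lerXn2r// nnegrE// (le_trans X0).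
have p0 x : (0 <= p x)%R by rewrite (le_trans _ (pX x))// expR_ge0.
have mp : measurable_fun [set: T] p.
  by apply: measurable_funB => //; exact: measurable_funM.
have mq : measurable_fun [set: T] q.
  apply: measurableT_comp => //.
  by apply: measurable_funB => //; exact: measurable_funM.
have pq A : G A -> \int[mu]_(x in A) (p x)%:E <= \int[mu]_(x in A) (q x)%:E.
  move=> GA; have mA := Gm GA.
  rewrite integral_affine// -cE// -integral_affine//.
  (* The affine function of [c] may be negative, so the comparison for signed functions is
     required. *)
  apply: le_integral_measurable => //.
  - apply/measurable_EFinP/measurable_funTS.
    by apply: measurable_funB => //; exact: measurable_funM.
  - exact/measurable_EFinP/measurable_funTS.
  - by move=> x _; rewrite lee_fin -addrA expR_ge1Dx.
pose W x := V x * (expR (lambda * c x - a))%:E.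
have W0 x : 0 <= W x by rewrite mule_ge0// lee_fin expR_ge0.
have mW : measurable_wrt G W.
  apply/(measurable_wrtP sG); apply: emeasurable_funM.
    exact/(measurable_wrtP sG).
  apply/measurable_EFinP; apply: measurableT_comp => //.
  apply: measurable_funB => //; apply: measurable_funM => //.
  exact/(measurable_wrtP sG).
have mV' : measurable_fun [set: T] V.
  exact/(measurable_fun_of_sub sG Gm)/(measurable_wrtP sG).
have mW' : measurable_fun [set: T] W.
  exact/(measurable_fun_of_sub sG Gm)/(measurable_wrtP sG).
apply: (@le_trans _ _ (\int[mu]_x (W x * (p x)%:E))).
  apply: ge0_le_integral => //.
  - by move=> x _; rewrite mule_ge0// lee_fin expR_ge0.
  - apply: emeasurable_funM => //; apply/measurable_EFinP.
    apply: measurableT_comp => //; apply: measurable_funB => //.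
    by apply: measurable_funM => //; exact: measurable_funB.
  - by apply: emeasurable_funM => //; exact/measurable_EFinP.
  - move=> x _; rewrite /W -muleA lee_wpmul2l// -EFinM lee_fin.
    rewrite (_ : lambda * (c x - X x) - a = lambda * c x - a + - (lambda * X x))%R.
      by rewrite expRD ler_wpM2l// expR_ge0.
    by rewrite mulrBr addrAC.
apply: (le_trans (le_integral_sub p0 (fun x => expR_ge0 _) mp mq pq W0 mW)).
rewrite le_eqVlt; apply/orP; left; apply/eqP; apply: eq_integral => x _.
by rewrite /W -muleA -EFinM -expRD addrA subrK subrr expR0 mule1.
Qed.

End conditional_exponential_moment.

(** * Expected product of the mixtures *)

Lemma emeasurable_prod_nat d (T : measurableType d) (R : realType)
    (f : nat -> T -> \bar R) (i n : nat) :
    (forall j, (i <= j < n)%N -> measurable_fun [set: T] (f j)) ->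
  measurable_fun [set: T] (fun x => (\prod_(i <= j < n) f j x)%E).
Proof.
elim: n => [|n IH] mf.
  by under eq_fun do rewrite big_geq//; exact: measurable_cst.
have [ni|ilen] := ltnP n i.
  by under eq_fun do rewrite big_geq//; exact: measurable_cst.
under eq_fun do rewrite big_nat_recr//=.
apply: emeasurable_funM; last by apply: mf; rewrite ilen /=.
by apply: IH => j /andP[ij jn]; apply: mf; rewrite ij ltnW.
Qed.

Section supermartingale.
Context d d' (T : measurableType d) (H : measurableType d') (R : realType).
Variables (mu : probability T R) (pi : probability H R) (n : nat).
Variables (F : nat -> set (set T)) (P : nat -> T -> probability H R).
Variable e : nat -> T * H -> R.
Hypotheses (sF : forall i, sigma_algebra [set: T] (F i))
  (Fm : forall i, F i `<=` measurable) (FS : forall i, F i `<=` F i.+1).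
Hypothesis FP : forall i, (i < n)%N -> forall B, measurable B ->
  measurable_wrt (F i) ((fun x => P i x B) : T -> \bar R).
Hypothesis Ppi : forall i, (i < n)%N -> forall x,
  (P i x : set H -> \bar R) `<< (pi : set H -> \bar R).
Hypothesis e0 : forall i z, 0 <= e i z.
Hypothesis me : forall i, (i < n)%N -> measurable_fun [set: T * H] (e i).
Hypothesis Fe : forall i, (i < n)%N -> forall h,
  measurable_wrt (F i.+1) (fun x => e i (x, h)).
Local Open Scope ereal_scope.
Hypothesis cond_e : forall i, (i < n)%N -> forall h (V : T -> \bar R),
  (forall x, 0 <= V x) -> measurable_wrt (F i) V ->
  \int[mu]_x (V x * (e i (x, h))%:E) <= \int[mu]_x V x.

Definition mixture i x := \int[P i x]_h (e i (x, h))%:E.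

Let tail i x := \prod_(i <= j < n) mixture j x.

Let mixture_ge0 i x : 0 <= mixture i x.
Proof. by apply: integral_ge0 => h _; rewrite lee_fin. Qed.

Let tail_ge0 i x : 0 <= tail i x.
Proof. by apply: (big_ind (fun y => 0 <= y)) => // *; exact: mule_ge0. Qed.

Let stoch_P i : (i < n)%N -> stoch_kernel (P i).
Proof.
move=> ilt B mB; apply: (measurable_fun_of_sub (sF i) (@Fm i)).
exact/(measurable_wrtP (sF i))/FP.
Qed.

Lemma measurable_mixture i : (i < n)%N -> measurable_fun [set: T] (mixture i).
Proof.
move=> ilt; apply: (measurable_integral_kernel (f := EFin \o e i)) => //.
- exact: stoch_P.
- by move=> z; rewrite lee_fin.
- by apply/measurable_EFinP; exact: me.
Qed.

Let measurable_tail i : measurable_fun [set: T] (tail i).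
Proof. by apply: emeasurable_prod_nat => j /andP[_]; exact: measurable_mixture. Qed.

(* A kernel [P i x] depending on [x] cannot be exchanged with the expectation
   over [x]; its density with respect to the fixed [pi] can, and is [F i]-measurable
   for each fixed [h]. *)
Lemma integral_tail_le i : (i <= n)%N -> forall W : T -> \bar R,
    (forall x, 0 <= W x) -> measurable_wrt (F i) W ->
  \int[mu]_x (W x * tail i x) <= \int[mu]_x W x.
Proof.
(* Downward induction on [i], run as an induction on [n - i]. *)
move=> ilen; rewrite -(subKn ilen); move: (n - i)%N (leq_subr i n) => {ilen i}.
elim=> [_|k IH kn] W W0 FW.
  by rewrite subn0; under eq_integral do rewrite /tail big_geq// mule1.
set i := (n - k.+1)%N in FW *.
have iS : i.+1 = (n - k)%N by rewrite /i subnSK.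
have ilt : (i < n)%N by rewrite iS leq_subr.
have {}IH V : (forall x, 0 <= V x) -> measurable_wrt (F i.+1) V ->
    \int[mu]_x (V x * tail i.+1 x) <= \int[mu]_x V x.
  by rewrite iS; apply: IH; exact: ltnW.
have mW : measurable_fun [set: T] W.
  exact/(measurable_fun_of_sub (sF i) (@Fm i))/(measurable_wrtP (sF i)).
have mtail : measurable_fun [set: T] (tail i.+1) by exact: measurable_tail.
have [p [p0 mpF pE]] :=
  kernel_density mu (sF i) (@Fm i) (FP ilt) (Ppi ilt).
have mp : measurable_fun [set: T * H] p.
  exact: (measurable_fun_of_subX (sF i) (@Fm i)).
have Fp h : measurable_wrt (F i) (fun x => p (x, h)).
  by apply/(measurable_wrtP (sF i)); exact: measurable_fun_pair1.
have Fwp h : measurable_wrt (F i) (fun x => W x * (p (x, h))%:E).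
  apply/(measurable_wrtP (sF i)); apply: emeasurable_funM.
    exact/(measurable_wrtP (sF i)).
  exact/measurable_EFinP/(measurable_wrtP (sF i)).
have mW1 : measurable_fun [set: T * H] (W \o fst) by exact: measurableT_comp.
have mt1 : measurable_fun [set: T * H] (tail i.+1 \o fst) by exact: measurableT_comp.
have mei : measurable_fun [set: T * H] (EFin \o e i) by by apply/measurable_EFinP; exact: me.
have mpi : measurable_fun [set: T * H] (EFin \o p) by exact/measurable_EFinP.
pose f (z : T * H) := W z.1 * (e i z)%:E * tail i.+1 z.1.
have f0 z : 0 <= f z by rewrite !mule_ge0// lee_fin.
have mf : measurable_fun [set: T * H] f.
  by apply: emeasurable_funM => //; exact: emeasurable_funM.
have mei2 x : measurable_fun [set: H] (fun h => (e i (x, h))%:E).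
  exact: (measurable_fun_pair2 x mei).
pose g (z : T * H) := W z.1 * (p z)%:E.
have g0 z : 0 <= g z by rewrite !mule_ge0// lee_fin.
have mg : measurable_fun [set: T * H] g by exact: emeasurable_funM.
pose fp (z : T * H) := f z * (p z)%:E.
have fp0 z : 0 <= fp z by rewrite !mule_ge0// lee_fin.
have mfp : measurable_fun [set: T * H] fp by exact: emeasurable_funM.
have -> : \int[mu]_x (W x * tail i x) = \int[mu]_x \int[P i x]_h f (x, h).
  apply: eq_integral => x _; rewrite /tail big_ltn// muleA /f /=.
  rewrite ge0_integralZr//; last 2 first.
  - exact: emeasurable_funM.
  - by move=> h _; rewrite mule_ge0// lee_fin.
  by rewrite ge0_integralZl// => h _; rewrite lee_fin.
rewrite pE// (@fubini_tonelli _ _ _ _ _ mu pi fp mfp fp0).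
(* The density identity applied to [W \o fst], together with the unit mass of [P i x], puts the
   right side in the same form as the left. *)
have -> : \int[mu]_x W x = \int[pi]_h \int[mu]_x g (x, h).
  rewrite -(@fubini_tonelli _ _ _ _ _ mu pi g mg g0) -(pE (W \o fst))//.
    apply: eq_integral => x _.
    transitivity (\int[P i x]_h (cst (W x) h)); last by [].
    by rewrite integral_cst// [X in _ * X](probability_setT (P i x)) mule1.
  by move=> z; exact: W0.
apply: ge0_le_integral => //.
- by move=> h _; exact: integral_ge0.
- exact: (@measurable_fun_fubini_tonelli_G _ _ _ _ _ mu fp).
- exact: (@measurable_fun_fubini_tonelli_G _ _ _ _ _ mu g).
move=> h _.
have Fw : measurable_wrt (F i.+1) (fun x => W x * (p (x, h))%:E * (e i (x, h))%:E).
  apply/(measurable_wrtP (sF i.+1)); apply: emeasurable_funM.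
    by apply/(measurable_wrtP (sF i.+1)) => B mB; exact/FS/Fwp.
  exact/measurable_EFinP/(measurable_wrtP (sF i.+1))/Fe.
(* For fixed [h], the induction hypothesis with weight [W * p * e i], measurable at time [i.+1],
   removes the tail; [cond_e] with weight [W * p], measurable at time [i], then removes [e i]. *)
apply: le_trans (cond_e ilt h (fun x => g0 (x, h)) (Fwp h)).
apply: le_trans (IH _ _ Fw); last by move=> x; rewrite !mule_ge0// lee_fin.
rewrite le_eqVlt; apply/orP; left; apply/eqP; apply: eq_integral => x _.
by rewrite /fp /f /= muleAC (muleAC (W x)).
Qed.

Lemma integral_prod_mixture_le1 :
  \int[mu]_x (\prod_(0 <= j < n) mixture j x) <= 1.
Proof.
have := @integral_tail_le 0%N isT (cst 1) (fun=> lee01).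
rewrite integral_cst// [X in _ * X](probability_setT mu) mule1.
under eq_integral do rewrite mul1e.
apply; apply/(measurable_wrtP (sF 0)); exact: measurable_cst.
Qed.

End supermartingale.

(** * Change of measure by Donsker-Varadhan *)

Section donsker_varadhan.
Context d (H : measurableType d) (R : realType).
Variables (P Q : probability H R).
Local Open Scope ereal_scope.

(** A zero integral would make a strictly positive function vanish almost everywhere under a
    probability. This gives meaning to the logarithm of the mixtures. *)
Lemma integral_expR_gt0 (g : H -> R) : measurable_fun [set: H] g ->
  0 < \int[P]_h (expR (g h))%:E.
Proof.
move=> mg; have mE : measurable_fun [set: H] (fun h => (expR (g h))%:E).
  by apply/measurable_EFinP; exact: measurableT_comp.
rewrite lt0e integral_ge0 ?andbT; last by move=> h _; rewrite lee_fin expR_ge0.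
apply/eqP => int0.
have /ae_eq_integral_abs : \int[P]_h `|(expR (g h))%:E| = 0.
  by rewrite -[RHS]int0; apply: eq_integral => h _; rewrite gee0_abs// lee_fin expR_ge0.
move=> /(_ measurableT mE) [N [mN N0 sN]].
have : [set: H] `<=` N.
  apply: subset_trans sN => h _ /(_ I) /= [] /eqP.
  by rewrite gt_eqF// expR_gt0.
rewrite subTset => NT; move: N0; rewrite NT => /eqP.
by rewrite [X in X == _](probability_setT P) onee_eq0.
Qed.

(* Integrates against [Q] the pointwise bound of [c] by [X], [ln r] and
   [expR (lambda * (c - X) - a) / r] given by [1 + y <= expR y], where [r = dQ/dP]. *)
Lemma donsker_varadhan (c X : H -> R) (K lambda a : R) :
    measurable_fun [set: H] c -> measurable_fun [set: H] X ->
    (forall h, (0 <= X h <= K)%R) -> (0 < lambda)%R ->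
    let xi := \int[P]_h (expR (lambda * (c h - X h) - a))%:E in
    xi < +oo ->
  \int[Q]_h (c h)%:E <= \int[Q]_h (X h)%:E + KL Q P * (lambda^-1)%:E +
    ((a + ln (fine xi)) / lambda)%:E.
Proof.
move=> mc mX XK lambda0 xi xioo.
have intX0 : 0 <= \int[Q]_h (X h)%:E.
  by apply: integral_ge0 => h _; rewrite lee_fin; case/andP: (XK h).
have intX : Q.-integrable [set: H] (EFin \o X).
  apply: (@le_integrable _ _ _ Q _ measurableT _ (EFin \o cst K)) => [|h _|].
  - exact/measurable_EFinP.
  - have /andP[X0 XleK] := XK h.
    by rewrite /= lee_fin !ger0_norm// (le_trans X0).
  - exact: finite_measure_integrable_cst.
have KLoo : KL Q P = +oo -> \int[Q]_h (c h)%:E <= \int[Q]_h (X h)%:E +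
    KL Q P * (lambda^-1)%:E + ((a + ln (fine xi)) / lambda)%:E.
  move=> ->; rewrite gt0_mulye ?lte_fin ?invr_gt0// addey; last first.
    by rewrite gt_eqF// (lt_le_trans _ intX0)// ltNy0.
  by rewrite addye// leey.
case QPE : (pselect ((Q : set H -> \bar R) `<< (P : set H -> \bar R))) => [QP|nQP];
  last by apply: KLoo; rewrite /KL QPE.
pose g h := (lambda * (c h - X h) - a)%R.
pose rn := Radon_Nikodym (charge_of_finite_measure Q) P.
pose r h := fine (rn h).
have KLE : KL Q P = \int[Q]_h (ln (r h))%:E by rewrite /KL QPE.
have rE h : (r h)%:E = rn h by rewrite /r fineK//; exact: Radon_Nikodym_fin_num.
have mr : measurable_fun [set: H] r.
  apply/measurable_EFinP; apply: (eq_measurable_fun rn) => [h _|].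
    by rewrite /= rE.
  by have /integrableP[] :=
    @Radon_Nikodym_integrable _ _ _ (charge_of_finite_measure Q) P QP.
have mg : measurable_fun [set: H] g.
  by apply: measurable_funB => //; apply: measurable_funM => //; exact: measurable_funB.
have QrE A : measurable A -> Q A = \int[P]_(h in A) (r h)%:E.
  move=> mA; rewrite [LHS](@Radon_Nikodym_integral _ _ _ (charge_of_finite_measure Q) P A QP mA).
  by apply: eq_integral => h _; rewrite rE.
have mlnr : measurable_fun [set: H] (fun h => ln (r h)).
  exact: measurableT_comp.
have mr_gt0 : measurable_fun [set: H] (fun h => 0 < r h)%R.
  exact: measurable_fun_ltr.
(* [rp] is the positive part of [r], and [ri] is its inverse where [r > 0], set to 0 elsewhere; the
   set [r <= 0] is [Q]-null. *)
pose rp h := (if (0 < r h)%R then r h else 0%R).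
pose ri h := (if (0 < r h)%R then expR (- ln (r h)) else 0%R).
have rp0 h : (0 <= rp h)%R by rewrite /rp; case: ltP => // /ltW.
have ri0 h : (0 <= ri h)%R by rewrite /ri; case: ifP => // _; exact: expR_ge0.
have mrp : measurable_fun [set: H] rp by exact: measurable_fun_ifT.
have mri : measurable_fun [set: H] ri.
  by apply: measurable_fun_ifT => //; apply: measurableT_comp => //; exact: measurableT_comp.
(* [Q] lies below the measure with density [rp] with respect to [P], and [ri * rp] is 0 or 1. *)
have int_div (u : H -> R) : (forall h, 0 <= u h)%R -> measurable_fun [set: H] u ->
    \int[P]_h (u h)%:E <= 1 -> \int[Q]_h (u h * ri h)%:E <= 1.
  move=> u0 mu Pu1.
  have mur : measurable_fun [set: H] (fun h => u h * ri h)%R by exact: measurable_funM.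
  have ur0 h : 0 <= (u h * ri h)%:E by rewrite lee_fin mulr_ge0.
  apply: (@le_trans _ _ (\int[density P rp0 mrp]_h (u h * ri h)%:E)).
    apply: ge0_integral_le_measure => // A mA; rewrite [leLHS](QrE A mA).
    apply: le_integral_measurable => //.
    - exact/measurable_EFinP/measurable_funTS.
    - exact/measurable_EFinP/measurable_funTS.
    - by move=> h _; rewrite lee_fin /rp; case: ltP.
  rewrite ge0_integral_density//; last exact/measurable_EFinP.
  apply: le_trans Pu1; apply: ge0_le_integral => //.
  - by move=> h _; rewrite mule_ge0// lee_fin.
  - by apply: emeasurable_funM; exact/measurable_EFinP.
  - exact/measurable_EFinP.
  - move=> h _; rewrite -EFinM lee_fin /ri /rp; case: ifPn => [rh|_].
      by rewrite expRN lnK// mulfVK// gt_eqF.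
    by rewrite mulr0.
(* The negative part of [ln r] is at most [ri], since [- ln r <= expR (- ln r)], and [ln r = 0] by
   default where [r <= 0]. So the divergence is never of the form [oo - oo]. *)
have lnr_neg : \int[Q]_h ((EFin \o (fun h => ln (r h)))^\- h) <= 1.
  apply: (@le_trans _ _ (\int[Q]_h (1 * ri h)%:E)); last first.
    apply: int_div => //.
    by rewrite integral_cst// [X in _ * X](probability_setT P) mule1.
  apply: ge0_le_integral => //.
  - exact/measurable_funeneg/measurable_EFinP.
  - by apply/measurable_EFinP; exact: measurable_funM.
  - move=> h _; rewrite funenegE /= -EFin_max lee_fin ge_max mul1r ri0 andbT.
    rewrite /ri; case: ltP => [_|r0]; last by rewrite ln0// oppr0.
    by rewrite (le_trans _ (expR_ge1Dx _))// lerDr.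
have [lnr_pos|lnr_pos] := eqVneq (\int[Q]_h ((EFin \o (fun h => ln (r h)))^\+ h)) +oo.
  apply: KLoo; rewrite KLE integralE lnr_pos addye// eqe_oppLR /=.
  by rewrite lt_eqF// (le_lt_trans lnr_neg)// ltry.
have intlnr : Q.-integrable [set: H] (EFin \o (fun h => ln (r h))).
  apply/integrableP; split; first exact/measurable_EFinP.
  rewrite (eq_integral (fun h => (EFin \o (fun h => ln (r h)))^\+ h +
    (EFin \o (fun h => ln (r h)))^\- h)); last first.
    by move=> h _; rewrite -[RHS]/((_ \+ _) h) -fune_abse.
  rewrite ge0_integralD//; last 2 first.
  - exact/measurable_funepos/measurable_EFinP.
  - exact/measurable_funeneg/measurable_EFinP.
  by rewrite lte_add_pinfty ?ltey// lt_eqF// (le_lt_trans lnr_neg)// ltry.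
pose L := ln (fine xi).
have xiE : xi = (expR L)%:E.
  have xi0 : 0 < xi by exact: integral_expR_gt0.
  have xifin : xi \is a fin_num by rewrite ge0_fin_numE// ltW.
  by rewrite lnK ?fineK// posrE fine_gt0// xi0.
(* The density of [P] tilted by [expR g] and normalized by [xi = expR L], divided by [r]. *)
pose w h := (expR (g h - L) * ri h)%R.
have w0 h : (0 <= w h)%R by rewrite mulr_ge0// expR_ge0.
have mgL : measurable_fun [set: H] (fun h => expR (g h - L)).
  by apply: measurableT_comp => //; exact: measurable_funB.
have mw : measurable_fun [set: H] w by exact: measurable_funM.
have Qw : \int[Q]_h (w h)%:E <= 1.
  apply: int_div => //.
  under eq_integral do rewrite addrC expRD EFinM.
  rewrite ge0_integralZl//; last first.
    by apply/measurable_EFinP; exact: measurableT_comp.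
  by rewrite -/xi xiE -EFinM -expRD addrC subrr expR0.
have intw : Q.-integrable [set: H] (EFin \o w).
  apply/integrableP; split; first exact/measurable_EFinP.
  rewrite (eq_integral (EFin \o w)) => [|h _]; last by rewrite /= ger0_norm.
  by rewrite (le_lt_trans Qw)// ltry.
(* [1 + y <= expR y] at [y = g - L - ln r] reads [g <= L - 1 + ln r + w]; solving for [c] gives the
   bound [b] with this constant [k]. *)
pose k := (a + L - 1)%R.
have intk : Q.-integrable [set: H] (EFin \o cst k) by exact: finite_measure_integrable_cst.
pose b h := (X h + lambda^-1 * (ln (r h) + (k + w h)))%R.
have mb : measurable_fun [set: H] b.
  apply: measurable_funD => //; apply: measurable_funM => //.
  by apply: measurable_funD => //; exact: measurable_funD.
(* The pointwise bound needs [r > 0]; on the [Q]-null complement [c] is replaced by [b]. *)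
pose c' h := (if (0 < r h)%R then c h else b h).
have mc' : measurable_fun [set: H] c' by exact: measurable_fun_ifT.
have -> : \int[Q]_h (c h)%:E = \int[Q]_h (c' h)%:E.
  apply: ae_eq_integral => //; [exact/measurable_EFinP..|].
  have mD : measurable [set h | (r h <= 0)%R].
    by rewrite -[X in measurable X]setTI; exact: measurable_fun_le.
  exists [set h | (r h <= 0)%R]; split => //.
  - apply/eqP; rewrite eq_le measure_ge0 andbT [leLHS](QrE _ mD).
    rewrite -(integral0 P [set h | (r h <= 0)%R]); apply: le_integral_measurable => //.
    exact/measurable_EFinP/measurable_funTS.
  - move=> h /= /not_implyP[_]; rewrite /c'; case: ltP => // _; exact: absurd.
apply: (@le_trans _ _ (\int[Q]_h (b h)%:E)).
  apply: le_integral_measurable => //; [exact/measurable_EFinP..|].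
  move=> h _; rewrite lee_fin /c'; case: ifPn => // rh.
  rewrite /b /k /w /ri rh -expRD -lerBlDl -(ler_pM2l lambda0) mulVKf ?gt_eqF//.
  have := expR_ge1Dx (g h - L - ln (r h)); rewrite /g; lra.
have -> : \int[Q]_h (b h)%:E = \int[Q]_h (X h)%:E +
    (lambda^-1)%:E * (KL Q P + (k%:E + \int[Q]_h (w h)%:E)).
  rewrite KLE; under eq_integral do rewrite EFinD EFinM !EFinD.
  have intkw : Q.-integrable [set: H] (fun h => k%:E + (w h)%:E).
    exact: (integrableD measurableT intk intw).
  have intlkw : Q.-integrable [set: H] (fun h => (ln (r h))%:E + (k%:E + (w h)%:E)).
    exact: (integrableD measurableT intlnr intkw).
  rewrite integralD//; last exact: integrableZl.
  rewrite integralZl// integralD// integralD//.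
  by rewrite integral_cst// [X in k%:E * X](probability_setT Q) mule1.
have KLfin : KL Q P \is a fin_num by rewrite KLE; exact: (integrable_fin_num _ intlnr).
have Xfin : \int[Q]_h (X h)%:E \is a fin_num by exact: (integrable_fin_num _ intX).
have wfin : \int[Q]_h (w h)%:E \is a fin_num by exact: (integrable_fin_num _ intw).
move: Qw; rewrite -(fineK KLfin) -(fineK Xfin) -(fineK wfin).
move: (fine (KL Q P)) (fine (\int[Q]_h (X h)%:E)) (fine (\int[Q]_h (w h)%:E)).
move=> kl x y; rewrite lee_fin => y1.
suff : (x + lambda^-1 * (kl + (k + y)) <= x + kl * lambda^-1 + (a + L) / lambda)%R.
  by rewrite -lee_fin.
rewrite -subr_ge0 [leRHS](_ : _ = lambda^-1 * (1 - y))%R; last by rewrite /k; ring.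
by rewrite mulr_ge0 ?invr_ge0 ?subr_ge0// ltW.
Qed.

End donsker_varadhan.

(** * Logarithms of products and Markov's inequality *)

Lemma ln_prod_lt (R : realType) (f : nat -> \bar R) (n : nat) (r : R) :
    (forall j, 0 < f j)%E -> (\prod_(0 <= j < n) f j < r%:E)%E ->
  (forall j, (j < n)%N -> (f j < +oo)%E) /\
  \sum_(0 <= j < n) ln (fine (f j)) <= ln r.
Proof.
move=> f0 fr.
have prod_gt0 k : (0 < \prod_(0 <= j < k) f j)%E.
  by apply: (big_ind (fun y => 0 < y)%E) => // *; exact: mule_gt0.
have prodE k : (\prod_(0 <= j < k) f j < +oo)%E ->
    (forall j, (j < k)%N -> (f j < +oo)%E) /\
    \sum_(0 <= j < k) ln (fine (f j)) = ln (fine (\prod_(0 <= j < k) f j)%E).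
  elim: k => [_|k IH]; first by split => //; rewrite !big_geq//= ln1.
  rewrite !big_nat_recr//= => fk.
  (* As the other factor is positive, [0 * +oo] is excluded and an infinite factor would make the
     product infinite. *)
  have fkoo : (f k < +oo)%E.
    by move: fk; case: (f k) (f0 k) => [s|//|//] _; [rewrite ltry|rewrite gt0_muley].
  have pkoo : (\prod_(0 <= j < k) f j < +oo)%E.
    move: fk; case: (\prod_(0 <= j < k) f j)%E (prod_gt0 k) => [s|//|//] _.
      by rewrite ltry.
    by rewrite gt0_mulye.
  have [fj ->] := IH pkoo; split.
    by move=> j; rewrite ltnS leq_eqVlt => /predU1P[->//|]; exact: fj.
  rewrite fineM ?ge0_fin_numE ?ltW// lnM//.
  - by rewrite posrE fine_gt0// prod_gt0.
  - by rewrite posrE fine_gt0// f0.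
have poo := lt_trans fr (ltry r).
have [? ->] := prodE n poo; split => //.
have pfin : (\prod_(0 <= j < n) f j)%E \is a fin_num by rewrite ge0_fin_numE// ltW.
have fp0 : 0 < fine (\prod_(0 <= j < n) f j)%E by rewrite fine_gt0// prod_gt0.
have pr : fine (\prod_(0 <= j < n) f j)%E < r by rewrite -lte_fin fineK.
by rewrite ler_ln ?posrE ?ltW// (lt_trans fp0).
Qed.

Lemma markov_probability d (T : measurableType d) (R : realType)
    (mu : probability T R) (f : T -> \bar R) (delta : R) :
    measurable_fun [set: T] f -> (forall x, 0 <= f x)%E ->
    (\int[mu]_x f x <= 1)%E -> 0 < delta ->
  measurable [set x | (f x < (delta^-1)%:E)%E] /\
  ((1 - delta)%:E <= mu [set x | (f x < (delta^-1)%:E)%E])%E.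
Proof.
move=> mf f0 f1 delta0; set A := [set x | _].
have mA : measurable A by rewrite -[A]setTI; exact: emeasurable_fun_infty_o.
split=> //; rewrite -(setCK A) probability_setC; last exact: measurableC.
rewrite EFinB leeB//.
have di0 : 0 < delta^-1 by rewrite invr_gt0.
have := le_integral_abse mu measurableT mf di0.
rewrite setTI (_ : [set x | _] = ~` A); last first.
  by apply/seteqP; split => x /=; rewrite /A /= gee0_abs// leNgt => /negP.
under eq_integral do rewrite gee0_abs//.
move=> /le_trans/(_ f1) /(lee_wpmul2l (x := delta%:E)); rewrite lee_fin ltW//.
by move=> /(_ isT); rewrite muleA -EFinM divff ?gt_eqF// mul1e mule1.
Qed.

(** * Assembly of the high-probability bound *)

Unset Implicit Arguments.

(* Indexing is 0-based: for i : 'I_m, coordinate [tnth S i] is z_{i+1},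
   [P i], [Q i] are P_{i+1}, Q_{i+1}, [F i] is F_i (so F_{(i+1)-1}), and
   [cond i h] is a version of E[ l(h, z_{i+1}) | F_i ]. *)
Theorem theorem2p3
  (dZ dH : measure_display) (R : realType)
  (Z : measurableType dZ) (H : measurableType dH) (m : nat)
  (loss : H -> Z -> R) (K : R)
  (mu : probability (m.-tuple Z) R)
  (F : nat -> set (set (m.-tuple Z)))
  (lambda delta : R)
  (P Q : 'I_m -> m.-tuple Z -> probability H R)
  (cond : 'I_m -> H -> m.-tuple Z -> R) :
  (0 < m)%N ->
  0 < K ->
  measurable_fun [set: H * Z] (fun p : H * Z => loss p.1 p.2) ->
  (forall h z, 0 <= loss h z <= K) ->
  filtration F -> adapted F ->
  0 < lambda -> 0 < delta < 1 ->
  online_predictive F P ->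
  (forall i, stoch_kernel (Q i)) ->
  (forall i : 'I_m,
     measurable_fun [set: H * m.-tuple Z] (fun p : H * m.-tuple Z => cond i p.1 p.2)) ->
  (forall (i : 'I_m) (h : H),
     is_cond_exp mu (F i) (fun S => loss h (tnth S i)) (cond i h)) ->
  exists A : set (m.-tuple Z), [/\ measurable A, ((1 - delta)%:E <= mu A)%E &
    forall S, A S ->
      (\sum_(i < m) \int[Q i S]_h (cond i h S)%:E <=
       \sum_(i < m) (\int[Q i S]_h (loss h (tnth S i))%:E
                     + KL (Q i S) (P i S) * (lambda^-1)%:E)
       + (lambda * m%:R * K ^+ 2 / 2)%:E
       + (ln (delta^-1) / lambda)%:E)%E].
Proof.
case: m mu F P Q cond => [//|n] mu F P Q cond _ K0 mloss lossK [sF [Fm FS]] adF.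
move=> lambda0 /andP[delta0 delta1] [mP FP P0 Pdom] mQ mcond Hcond.
pose T : measurableType _ := (n.+1.-tuple Z)%type.
(* The first kernel is data-free, so its value at an arbitrary [point] is its value everywhere. *)
pose pi := P ord0 point.
pose a := lambda ^+ 2 * K ^+ 2 / 2.
(* Indices become natural numbers; [inord] is faithful below [n.+1]. *)
pose P' (i : nat) := P (inord i).
pose e (i : nat) (z : T * H) :=
  expR (lambda * (cond (inord i) z.2 z.1 - loss z.2 (tnth z.1 (inord i))) - a).
have Ppi i : (i < n.+1)%N -> forall x,
    (P' i x : set H -> \bar R) `<< (pi : set H -> \bar R).
  elim: i => [_ x|i IH ilt x].
    rewrite (_ : P' 0%N x = pi)//; last first.
      by rewrite /P' (_ : inord 0 = ord0) ?(P0 ord0 _ x point)//; apply/val_inj; rewrite /= inordK.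
  apply: (null_dominates_trans _ (IH (ltnW ilt) x)).
  by apply: Pdom; rewrite !inordK// ltnW.
have mtn i : measurable_fun [set: T] (fun S : T => tnth S i) by exact: measurable_tnth.
have mc i : measurable_fun [set: T * H] (fun z : T * H => cond i z.2 z.1).
  exact: (measurableT_comp (mcond i) (@measurable_swap _ _ T H)).
have ml i : measurable_fun [set: T * H] (fun z : T * H => loss z.2 (tnth z.1 i)).
  apply: (measurableT_comp mloss (g := fun z : T * H => (z.2, tnth z.1 i))).
  by apply: measurable_fun_pair => //; exact: (measurableT_comp (mtn i) (@measurable_fst _ _ T H)).
have me i : (i < n.+1)%N -> measurable_fun [set: T * H] (e i).
  move=> _; apply: measurableT_comp => //; apply: measurable_funB => //.
  by apply: measurable_funM => //; exact: measurable_funB.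
have mlh h : measurable_fun [set: Z] (loss h) by exact: (measurable_fun_pair2 h mloss).
(* The conditional expectation is known at time [i] and the loss only at [i.+1], by adaptedness. *)
have Fe i : (i < n.+1)%N -> forall h, measurable_wrt (F i.+1) (fun x => e i (x, h)).
  move=> ilt h; apply/(measurable_wrtP (sF i.+1)); rewrite /e /=.
  apply: measurableT_comp => //.
  apply: measurable_funB => //; apply: measurable_funM => //; apply: measurable_funB.
    apply/(measurable_wrtP (sF i.+1)) => B mB; apply: FS.
    by have [+ _ _] := Hcond (inord i) h; rewrite inordK//; exact.
  apply/(measurable_wrtP (sF i.+1)) => B mB.
  have := adF (inord i) (loss h @^-1` B); rewrite inordK//; apply.
  by rewrite -[X in measurable X]setTI; exact: mlh.
have cond_e i : (i < n.+1)%N -> forall h (V : T -> \bar R),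
    (forall x, 0 <= V x)%E -> measurable_wrt (F i) V ->
    (\int[mu]_x (V x * (e i (x, h))%:E) <= \int[mu]_x V x)%E.
  move=> ilt h V V0 FV.
  apply: (cond_exp_exponential_moment (sF i) (Fm i) (K := K)) => //.
  - exact: (measurableT_comp (mlh h) (mtn (inord i))).
  - by have := Hcond (inord i) h; rewrite inordK.
have FP' i : (i < n.+1)%N -> forall B, measurable B ->
    measurable_wrt (F i) ((fun x => P' i x B) : T -> \bar R).
  by move=> ilt B mB; have := FP (inord i) B mB; rewrite inordK.
have e0 i z : 0 <= e i z by exact: expR_ge0.
pose xi i (S : T) := mixture P' e i S.
pose f S := (\prod_(0 <= j < n.+1) xi j S)%E.
have mf : measurable_fun [set: T] f.
  apply: emeasurable_prod_nat => j /andP[_ jn].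
  exact: (measurable_mixture sF Fm FP').
have xi_gt0 S i : (0 < xi i S)%E.
  apply: integral_expR_gt0; apply: measurable_funB => //.
  apply: measurable_funM => //; apply: measurable_funB.
    exact: (measurable_fun_pair2 S (mc (inord i))).
  exact: (measurable_fun_pair2 S (ml (inord i))).
have f0 S : (0 <= f S)%E.
  by apply: (big_ind (fun y => 0 <= y)%E) => // *; [exact: mule_ge0|exact: ltW].
have f1 : (\int[mu]_S f S <= 1)%E.
  exact: (integral_prod_mixture_le1 sF Fm FS FP' Ppi e0 me Fe cond_e).
have [mA muA] := markov_probability mf f0 f1 delta0.
exists [set S | (f S < (delta^-1)%:E)%E]; split => // S fS.
have [xioo sum_ln] := ln_prod_lt (xi_gt0 S) fS.
(* On the event, the product of the mixtures is below [delta^-1], so each of them is finite and the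
   change of measure applies. *)
have bound (i : 'I_n.+1) : (\int[Q i S]_h (cond i h S)%:E <=
    \int[Q i S]_h (loss h (tnth S i))%:E + KL (Q i S) (P i S) * (lambda^-1)%:E +
    ((a + ln (fine (xi i S))) / lambda)%:E)%E.
  have xiE : (xi i S = \int[P i S]_h
      (expR (lambda * (cond i h S - loss h (tnth S i)) - a))%:E)%E.
    by rewrite /xi /mixture /P' /e inord_val.
  rewrite xiE; apply: (@donsker_varadhan _ _ _ _ _ _ _ K) => //.
  - exact: (measurable_fun_pair2 S (mc i)).
  - exact: (measurable_fun_pair2 S (ml i)).
  - by rewrite -xiE; exact: xioo.
apply: (le_trans (lee_sum _ (fun i _ => bound i))).
(* The [n.+1] copies of [a / lambda] give the [K ^+ 2] term, and [sum_ln] bounds the logarithms by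
   [ln (delta^-1)]. *)
rewrite big_split/= -addeA leeD2l// sumEFin -EFinD lee_fin.
rewrite -mulr_suml big_split/= sumr_const card_ord -mulr_natr.
rewrite big_mkord in sum_ln.
rewrite mulrDl lerD//; last by rewrite ler_pM2r ?invr_gt0.
by rewrite /a le_eqVlt; apply/orP; left; apply/eqP; field; exact: lt0r_neq0.
Qed.
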